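(* There exists a one-sided error, non-adaptive property testing algorithm for the property of having Boolean rank at most $d$, whose query complexity is $\tilde{O}(d^4/\epsilon^6)$ (in particular, independent of $n$). That is, given parameters $d$ and $\epsilon$ and query access to a $(0,1)$-matrix $M$ of size $n\times n$, the algorithm makes $\tilde{O}(d^4/\epsilon^6)$ queries to entries of $M$, all chosen in advance, always accepts if $M$ has Boolean rank at most $d$, and rejects with probability at least $2/3$ if $M$ is $\epsilon$-far from Boolean rank at most $d$.
   Context: The Boolean rank of a $(0,1)$-matrix $M$ of size $n\times n$ is the minimal $r$ such that $M = X\cdot Y$ with $X$ an $n\times r$ and $Y$ an $r\times n$ $(0,1)$-matrix, where addition and multiplication are Boolean ($1+1=1$); equivalently, the minimal number of all-ones combinatorial rectangles (submatrices on a set of rows times a set of columns) needed to cover all $1$-entries of $M$. For $\epsilon\in[0,1]$, $M$ is $\epsilon$-far from Boolean rank at most $d$ if more than $\epsilon n^2$ entries of $M$ must be modified to obtain a $(0,1)$-matrix of Boolean rank at most $d$; otherwise it is $\epsilon$-close. A testing algorithm accesses $M$ only through queries of single entries; it is one-sided error if it accepts matrices with the property with probability 1, and non-adaptive if it selects all its queries in advance. Query complexity is the number of queried entries. *)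

(* Defs.v *)
From mathcomp Require Import all_boot all_order all_algebra.
From mathcomp Require Import reals exp.
Set Implicit Arguments.
Unset Strict Implicit.
Unset Printing Implicit Defensive.
Import Order.TTheory GRing.Theory Num.Theory.
Local Open Scope ring_scope.

(* The product over the Boolean semiring (1 + 1 = 1).  The library's [*m] is
   not suitable: its ring structure on [bool] is the field with two elements. *)
Definition boolmx_mul (m r n : nat) (X : 'M[bool]_(m, r)) (Y : 'M[bool]_(r, n)) :
    'M[bool]_(m, n) :=
  \matrix_(i, j) [exists k, X i k && Y k j].

Definition bool_factors (m n : nat) (M : 'M[bool]_(m, n)) (r : nat) : bool :=
  [exists X : 'M[bool]_(m, r), exists Y : 'M[bool]_(r, n), M == boolmx_mul X Y].

Lemma bool_factors_ex (m n : nat) (M : 'M[bool]_(m, n)) :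
  exists r, bool_factors M r.
Proof.
exists n; apply/existsP; exists M.
apply/existsP; exists (\matrix_(i, j) (i == j)); apply/eqP/matrixP => i j.
rewrite mxE; apply/idP/existsP => [Mij|[k]]; first by exists j; rewrite Mij mxE eqxx.
by rewrite mxE => /andP[Mik /eqP<-].
Qed.

Definition bool_rank (m n : nat) (M : 'M[bool]_(m, n)) : nat :=
  ex_minn (bool_factors_ex M).

Definition mx_dist (n : nat) (M N : 'M[bool]_n) : nat :=
  #|[set e : 'I_n * 'I_n | M e.1 e.2 != N e.1 e.2]|.

Definition far_from_bool_rank (R : realType) (n d : nat) (eps : R)
    (M : 'M[bool]_n) : Prop :=
  forall N : 'M[bool]_n, (bool_rank N <= d)%N ->
    eps * (n ^ 2)%:R < (mx_dist M N)%:R.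

(* A non-adaptive randomized algorithm with query access to an n x n matrix:
   the queried entries depend only on the random seed, and the decision depends
   only on the seed and on the list of answers, given in the order of the
   queries. *)
Record nonadaptive_tester (R : realType) (n : nat) := NonadaptiveTester {
  seed : finType;
  seed_prob : seed -> R;
  seed_prob_ge0 : forall s, 0 <= seed_prob s;
  seed_prob_sum1 : \sum_s seed_prob s = 1;
  queries : seed -> seq ('I_n * 'I_n);
  decide : seed -> seq bool -> bool
}.

Section Tester.
Variables (R : realType) (n : nat) (T : nonadaptive_tester R n).

Definition accepts (M : 'M[bool]_n) (s : seed T) : bool :=
  decide s [seq M e.1 e.2 | e <- queries s].

Definition accept_prob (M : 'M[bool]_n) : R :=
  \sum_(s | accepts M s) seed_prob s.

Definition reject_prob (M : 'M[bool]_n) : R :=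
  \sum_(s | ~~ accepts M s) seed_prob s.

Definition query_complexity : nat := \max_(s : seed T) size (queries s).

End Tester.

(* A quantity is soft-O of g when it is at most [soft_bound C k g] for some
   constants C and k; the shift by 2 keeps the logarithm bounded away from 0
   for g near 1. *)
Definition soft_bound (R : realType) (C : R) (k : nat) (g : R) : R :=
  C * (g * ln (2 + g) ^+ k).

(* Main.v *)
(* Sample m entries independently, query the submatrix spanned by their rows and
   columns, and accept iff the answers extend to a matrix of Boolean rank at most
   d.  Suppose they do, through rectangles X_k x Y_k (k < d), and read the sample
   one entry at a time, keeping candidate rows R_k and columns C_k that contain
   the sampled part of X_k and Y_k.  A sampled 1-entry (r, c) lies in some
   X_k x Y_k, after which R_k loses the rows with a 0 in column c, and C_k the
   columns with a 0 in row r.  Call a row of R_k (a column of C_k) light if it has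
   fewer than theta = eps n / 2d zeros inside R_k x C_k, and a 1-entry beneficial
   if no rectangle of light rows and light columns contains it.  The light
   rectangles form a matrix of rank at most d which differs from M in at most
   (number of beneficial entries) + d n theta places, so if M is far then at
   least eps n^2 / 2 entries are beneficial, whatever the R_k and C_k are.
   Assigning a beneficial entry to rectangle k lowers the sum of all #|R_k| + #|C_k|
   by at least theta; this happens at most D ~ 4 d^2 / eps times, with d choices of k each
   time.  Weighing every assignment by 1 / 2d bounds the acceptance probability
   by (2d)^D (1 - eps / 4)^m, which is at most 1/3 for m = O~(d^2 / eps^2). *)
Require Import Defs.
From mathcomp Require Import all_boot all_order all_algebra.
From mathcomp Require Import reals sequences exp.
From mathcomp Require Import ring lra zify.
Set Implicit Arguments.
Unset Strict Implicit.
Unset Printing Implicit Defensive.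
Import Order.TTheory GRing.Theory Num.Theory.
Local Open Scope ring_scope.

(** * Boolean factorizations, and sums over tuples *)

Lemma bool_factors_widen (m n r d : nat) (M : 'M[bool]_(m, n)) :
  (r <= d)%N -> bool_factors M r -> bool_factors M d.
Proof.
move=> le_rd /existsP[X /existsP[Y /eqP->]].
(* [X] is padded with zero columns and [Y] with zero rows. *)
apply/existsP; exists (\matrix_(i, k) [exists k' : 'I_r, (k' == k :> nat) && X i k']).
apply/existsP; exists (\matrix_(k, j) [exists k' : 'I_r, (k' == k :> nat) && Y k' j]).
apply/eqP/matrixP => i j; rewrite !mxE; apply/existsP/existsP => -[k].
  move=> /andP[Xk Yk]; exists (widen_ord le_rd k); rewrite !mxE.
  by apply/andP; split; apply/existsP; exists k; rewrite eqxx.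
rewrite !mxE => /andP[/existsP[k1 /andP[/eqP e1 X1]] /existsP[k2 /andP[/eqP e2 Y2]]].
by exists k1; rewrite X1 (_ : k1 = k2) //; apply: ord_inj; rewrite e1 e2.
Qed.

Lemma bool_rank_leP (m n d : nat) (M : 'M[bool]_(m, n)) :
  reflect (bool_factors M d) (bool_rank M <= d)%N.
Proof.
rewrite /bool_rank; case: ex_minnP => r Mr r_min.
by apply: (iffP idP) => [/bool_factors_widen|]; [apply|exact: r_min].
Qed.

Lemma big_tuple_cons (V : nmodType) (E : finType) (m : nat) (F : m.+1.-tuple E -> V) :
  \sum_t F t = \sum_x \sum_(t : m.-tuple E) F (cons_tuple x t).
Proof.
rewrite pair_bigA /=.
rewrite (reindex (fun p : E * m.-tuple E => cons_tuple p.1 p.2)) //=.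
exists (fun t => (thead t, behead_tuple t)) => [[x t] _|t _] /=.
  by congr pair; apply: val_inj.
by rewrite [RHS]tuple_eta; apply: val_inj.
Qed.

(** * Candidate rectangles and the count of consistent samples *)

Section Rectangles.
Variables (R : realType) (n d : nat) (M : 'M[bool]_n).
Implicit Types (st : 'I_d -> {set 'I_n} * {set 'I_n}) (x : 'I_n * 'I_n).

(* [st k] holds the rows and columns that the k-th rectangle may still use. *)
Definition refine st (k : 'I_d) x : 'I_d -> {set 'I_n} * {set 'I_n} :=
  fun j => if j == k then ([set r in (st k).1 | M r x.2], [set c in (st k).2 | M x.1 c])
           else st j.

Definition weight st : nat := \sum_k (#|(st k).1| + #|(st k).2|).

Definition light_rows (theta : R) st k : {set 'I_n} :=
  [set r in (st k).1 | #|[set c in (st k).2 | ~~ M r c]|%:R < theta].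

Definition light_cols (theta : R) st k : {set 'I_n} :=
  [set c in (st k).2 | #|[set r in (st k).1 | ~~ M r c]|%:R < theta].

Definition light_mx (theta : R) st : 'M[bool]_n :=
  \matrix_(r, c) [exists k, (r \in light_rows theta st k) && (c \in light_cols theta st k)].

Definition beneficial (theta : R) st : {set 'I_n * 'I_n} :=
  [set x | M x.1 x.2 && ~~ light_mx theta st x.1 x.2].

(** Containment is asked only of sampled rows and columns, since the sample says nothing about a
    rectangle elsewhere. *)
Definition consistent st (s : seq ('I_n * 'I_n)) : bool :=
  [exists X : 'M[bool]_(n, d), exists Y : 'M[bool]_(d, n),
    all (fun e => all (fun f => M e.1 f.2 == boolmx_mul X Y e.1 f.2) s) s &&
    all (fun e => [forall k, (X e.1 k ==> (e.1 \in (st k).1)) &&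
                             (Y k e.2 ==> (e.2 \in (st k).2))]) s].

Lemma consistent_behead st x s : consistent st (x :: s) -> consistent st s.
Proof.
move=> /existsP[X /existsP[Y /andP[/allP H1 /= /andP[_ H2]]]].
apply/existsP; exists X; apply/existsP; exists Y; rewrite H2 andbT.
apply/allP => e es; have /H1/= : e \in x :: s by rewrite inE es orbT.
by case/andP.
Qed.

(** Take a rectangle [k] covering [x]. A sampled row of it forms with column [x.2] a queried entry
    covered by [k], so [M] is 1 there and the row survives the refinement; columns are symmetric. *)
Lemma consistent_refine st x s : M x.1 x.2 -> consistent st (x :: s) ->
  exists k, [/\ x.1 \in (st k).1, x.2 \in (st k).2 & consistent (refine st k x) s].
Proof.
move=> Mx /existsP[X /existsP[Y /andP[/allP H1 /allP H2]]].
have H e f : e \in x :: s -> f \in x :: s -> M e.1 f.2 = boolmx_mul X Y e.1 f.2.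
  by move=> es fs; apply/eqP; apply: (allP (H1 e es)).
have := H x x (mem_head _ _) (mem_head _ _); rewrite Mx mxE => /esym/existsP[k /andP[Xk Yk]].
exists k; have /forallP/(_ k) := H2 x (mem_head _ _); rewrite Xk Yk /= => /andP[-> ->]; split=> //.
apply/existsP; exists X; apply/existsP; exists Y; apply/andP; split.
  apply/allP => e es; apply/allP => f fs.
  by rewrite H // inE ?es ?fs orbT.
apply/allP => e es; have es' : e \in x :: s by rewrite inE es orbT.
apply/forallP => j; have /forallP/(_ j)/andP[/implyP HX /implyP HY] := H2 e es'.
rewrite /refine; case: eqP => [jk|_]; last by apply/andP; split; apply/implyP.
subst j; apply/andP; split; apply/implyP => h /=; rewrite inE ?HX ?HY //=.
  by rewrite (H e x) ?mem_head // mxE; apply/existsP; exists k; rewrite h.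
by rewrite (H x e) ?mem_head // mxE; apply/existsP; exists k; rewrite h Xk.
Qed.

(** Since [x] lies in no light rectangle, its row or its column is heavy in candidate [k]. The zeros
    of a heavy row, at least [theta] many, are the columns removed; a heavy column likewise removes
    rows. *)
Lemma weight_refine (theta : R) st k x :
  x \in beneficial theta st -> x.1 \in (st k).1 -> x.2 \in (st k).2 ->
  (weight (refine st k x))%:R + theta <= (weight st)%:R.
Proof.
rewrite inE mxE => /andP[_ /existsPn/(_ k)]; rewrite !inE => + xr xc; rewrite xr xc /=.
rewrite negb_and -!leNgt => heavy.
have split_card (A : {set 'I_n}) (p : pred 'I_n) :
    #|A| = (#|[set a in A | p a]| + #|[set a in A | ~~ p a]|)%N.
  rewrite -(cardsID [set a | p a] A).
  by congr addn; apply: eq_card => a; rewrite !inE // andbC.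
have -> : weight st = (weight (refine st k x) + (#|[set r in (st k).1 | ~~ M r x.2]| +
    #|[set c in (st k).2 | ~~ M x.1 c]|))%N.
  rewrite /weight (bigD1 k) //= [in RHS](bigD1 k) //=.
  rewrite [X in _ = (_ + X + _)%N](eq_bigr (fun j => #|(st j).1| + #|(st j).2|)%N);
    last by move=> j /negPf jk; rewrite /refine jk.
  rewrite /refine eqxx /=.
  rewrite (split_card (st k).1 (M^~ x.2)) (split_card (st k).2 (M x.1)).
  move=> /=; lia.
rewrite natrD lerD2l natrD.
by case/orP: heavy => h; apply: (le_trans h); rewrite ?lerDl ?lerDr.
Qed.

Lemma bool_rank_light_mx (theta : R) st : (bool_rank (light_mx theta st) <= d)%N.
Proof.
apply/bool_rank_leP/existsP; exists (\matrix_(r, k) (r \in light_rows theta st k)).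
apply/existsP; exists (\matrix_(k, c) (c \in light_cols theta st k)).
apply/eqP/matrixP => r c; rewrite !mxE.
by apply: eq_existsb => k; rewrite !mxE.
Qed.

(** A differing 1-entry is beneficial. A differing 0-entry is a zero of a light row [r] within some
    candidate [k]; each of the [d * n] pairs [(k, r)] yields at most [theta] of these. *)
Lemma dist_light_mx (theta : R) st : 0 <= theta ->
  (mx_dist M (light_mx theta st))%:R <= #|beneficial theta st|%:R + (d * n)%:R * theta.
Proof.
move=> theta0.
pose Z k r : {set 'I_n} := if r \in light_rows theta st k then
   [set c in (st k).2 | ~~ M r c] else set0.
have card_Z k r : #|Z k r|%:R <= theta.
  by rewrite /Z; case: ifP; rewrite ?cards0 // inE => /andP[_ /ltW].
apply: (@le_trans _ _ (#|beneficial theta st|%:R + \sum_k \sum_r #|Z k r|%:R)); last first.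
  rewrite lerD2l (le_trans (ler_sum _ (fun k _ => ler_sum _ (fun r _ => card_Z k r)))) //.
  by rewrite !sumr_const !card_ord -mulrnA mulr_natl mulnC.
rewrite pair_bigA /= -natr_sum -natrD ler_nat /mx_dist.
set B := beneficial theta st.
set A := [set e | _].
apply: (@leq_trans #|B :|: \bigcup_p [set (p.2, c) | c in Z p.1 p.2]|).
  apply/subset_leq_card/subsetP => e; rewrite !inE.
  case Me : (M e.1 e.2) => /=; first by case: (light_mx _ _ _ _).
  rewrite negbK mxE => /existsP[k /andP[er]].
  rewrite inE => /andP[ec _]; apply/bigcupP; exists (k, e.1) => //.
  apply/imsetP; exists e.2; last by case: (e).
  by rewrite /Z /= er inE ec Me.
apply: (leq_trans (leq_card_setU _ _).1); rewrite leq_add2l.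
apply: (@leq_trans (\sum_p #|[set (p.2, c) | c in Z p.1 p.2]|)); last first.
  by apply: leq_sum => p _; exact: leq_imset_card.
elim/big_ind2: _ => [|A1 a1 A2 a2 h1 h2|//]; first by rewrite cards0.
exact: leq_trans (leq_card_setU _ _).1 (leq_add h1 h2).
Qed.

Lemma card_consistent (theta q : R) (D m : nat) st :
  (0 < d)%N -> 0 < theta -> 0 <= q <= 1 ->
  (forall st', q * #|{: 'I_n * 'I_n}|%:R <= #|beneficial theta st'|%:R) ->
  (weight st)%:R <= D%:R * theta ->
  #|[set t : m.-tuple ('I_n * 'I_n) | consistent st t]|%:R <=
    (2 * d%:R) ^+ D * ((1 - q / 2) * #|{: 'I_n * 'I_n}|%:R) ^+ m.
Proof.
move=> d0 theta0 q01 many.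
have d1 : 1 <= d%:R :> R by rewrite ler1n.
set N : R := #|{: 'I_n * 'I_n}|%:R; have N0 : 0 <= N by rewrite ler0n.
set rho := 1 - q / 2; have rho0 : 0 <= rho by rewrite /rho; lra.
have cardE m' st' : #|[set t : m'.-tuple ('I_n * 'I_n) | consistent st' t]| =
    (\sum_(t : m'.-tuple ('I_n * 'I_n)) consistent st' t)%N.
  by rewrite -sum1dep_card big_mkcond.
(* [D] bounds the beneficial assignments still possible, so it must vary with [st]. *)
elim: m D st => [|m IH] D st wst.
  rewrite expr0 mulr1 (@le_trans _ _ 1) ?exprn_ege1 //; last by lra.
  by rewrite lern1 (leq_trans (max_card _)) // card_tuple.
set B := beneficial theta st.
pose a := (2 * d%:R) ^+ D * (rho * N) ^+ m.
have a0 : 0 <= a by rewrite mulr_ge0 ?exprn_ge0 ?mulr_ge0 ?ler0n.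
have term x : (\sum_(t : m.-tuple ('I_n * 'I_n)) consistent st (x :: t))%:R <=
    a - (x \in B)%:R * (a / 2).
  case: (boolP (x \in B)) => xB /=; last first.
    rewrite mul0r subr0 (le_trans _ (IH _ _ wst)) // cardE ler_nat.
    apply: leq_sum => t _.
    by case: (boolP (consistent st (x :: t))) => // /consistent_behead->.
  have Mx : M x.1 x.2 by move: xB; rewrite inE => /andP[].
  pose K := [pred k | (x.1 \in (st k).1) && (x.2 \in (st k).2)].
  apply: (@le_trans _ _ (\sum_(k | K k)
      #|[set t : m.-tuple ('I_n * 'I_n) | consistent (refine st k x) t]|%:R)).
    rewrite -natr_sum ler_nat (eq_bigr _ (fun k _ => cardE _ _)) exchange_big /=.
    apply: leq_sum => t _.
    case: (boolP (consistent st (x :: t))) => // /(consistent_refine Mx)[k [xr xc ck]].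
    by rewrite (bigD1 k) /= ?ck // xr xc.
  have step k : K k ->
      #|[set t : m.-tuple ('I_n * 'I_n) | consistent (refine st k x) t]|%:R <=
      a / (2 * d%:R).
    move=> /andP[xr xc]; have := weight_refine xB xr xc => wk.
    (* With [D = 0] the weight is 0 and cannot drop by [theta]. *)
    case: D wst @a a0 => [|D] wst a a0.
      by have : 0 <= (weight (refine st k x))%:R :> R; [rewrite ler0n|lra].
    apply: (le_trans (IH D _ _)).
      by rewrite -natr1 mulrDl mul1r in wst; lra.
    rewrite le_eqVlt; apply/orP; left; apply/eqP; rewrite /a exprSr.
    by field; rewrite pnatr_eq0 -lt0n.
  apply: (le_trans (ler_sum _ step)); rewrite sumr_const.
  (* At most [d] choices of [k], each worth [a / (2 * d)], add up to at most half of [a]. *)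
  apply: (@le_trans _ _ ((a / (2 * d%:R)) *+ d)).
    apply: ler_wpMn2l; first by apply: divr_ge0 => //; lra.
    by apply: leq_trans (max_card _) _; rewrite card_ord.
  rewrite -[_ *+ d]mulr_natr le_eqVlt; apply/orP; left; apply/eqP.
  by field; rewrite pnatr_eq0 -lt0n.
rewrite cardE big_tuple_cons natr_sum (le_trans (ler_sum _ (fun x _ => term x))) //.
rewrite sumrB sumr_const -mulr_suml -natr_sum.
rewrite (_ : (\sum_x (x \in B))%N = #|B|); last by rewrite -sum1_card [RHS]big_mkcond.
have := many st; rewrite -/B -/N => hB.
rewrite -[_ *+ _]mulr_natr -/N.
have -> : (2 * d%:R) ^+ D * (rho * N) ^+ m.+1 = a * N - (q * N) * (a / 2).
  by rewrite exprS /a /rho; ring.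
by rewrite lerD2l lerN2 ler_wpM2r // divr_ge0.
Qed.

End Rectangles.

(** Full candidate sets constrain nothing, so a factorization of [N] serves as witness. *)
Lemma consistent_bool_rank (n d : nat) (M N : 'M[bool]_n) (t : seq ('I_n * 'I_n)) :
  (bool_rank N <= d)%N ->
  [seq N e.1 e.2 | e <- [seq (e.1, f.2) | e <- t, f <- t]] =
    [seq M e.1 e.2 | e <- [seq (e.1, f.2) | e <- t, f <- t]] ->
  consistent M (fun _ : 'I_d => ([set: 'I_n], [set: 'I_n])) t.
Proof.
move=> /bool_rank_leP/existsP[X /existsP[Y /eqP NE]] /eq_in_map agree.
apply/existsP; exists X; apply/existsP; exists Y; apply/andP; split.
  apply/allP => e es; apply/allP => f fs; rewrite -NE.
  by have /= <- := agree (e.1, f.2) (allpairs_f (fun e f => (e.1, f.2)) es fs).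
by apply/allP => e _; apply/forallP => k; rewrite !inE !implybT.
Qed.

(* No entry can be sampled from a 0 x 0 matrix, hence the factor [0 < n]. *)
Definition sample (n m : nat) : finType := ((0 < n) * m)%N.-tuple ('I_n * 'I_n).

Lemma card_sample_gt0 (n m : nat) : (0 < #|{: sample n m}|)%N.
Proof. by rewrite card_tuple card_prod card_ord; case: n => //= n; rewrite expn_gt0. Qed.

(** * The sampling tester *)

Section SamplingTester.
Variables (R : realType) (n d m : nat).

Lemma sample_prob_ge0 (s : sample n m) : 0 <= #|{: sample n m}|%:R^-1 :> R.
Proof. by rewrite invr_ge0. Qed.

Lemma sample_prob_sum1 : \sum_(s : sample n m) #|{: sample n m}|%:R^-1 = 1 :> R.
Proof.
by rewrite sumr_const -[_ *+ _]mulr_natr mulVf // pnatr_eq0 -lt0n card_sample_gt0.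
Qed.

Definition sample_queries (s : sample n m) : seq ('I_n * 'I_n) :=
  [seq (e.1, f.2) | e <- tval s, f <- tval s].

Definition sampling_tester : nonadaptive_tester R n :=
  NonadaptiveTester sample_prob_ge0 sample_prob_sum1 sample_queries
    (fun s answers => [exists N : 'M[bool]_n, (bool_rank N <= d)%N &&
       ([seq N e.1 e.2 | e <- sample_queries s] == answers)]).

Lemma query_complexity_sampling : (query_complexity sampling_tester <= m * m)%N.
Proof.
apply/bigmax_leqP => s _ /=; rewrite size_allpairs size_tuple.
by case: (0 < n)%N; rewrite ?mul1n.
Qed.

Lemma accept_prob_sampling (M : 'M[bool]_n) :
  (bool_rank M <= d)%N -> accept_prob sampling_tester M = 1.
Proof.
move=> rkM; rewrite -sample_prob_sum1 /accept_prob; apply: eq_bigl => s.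
by apply/existsP; exists M; rewrite rkM /=.
Qed.

Lemma reject_prob_sampling (M : 'M[bool]_n) :
  1 - #|[set t : ((0 < n) * m).-tuple ('I_n * 'I_n) |
          consistent M (fun _ : 'I_d => ([set: 'I_n], [set: 'I_n])) t]|%:R /
      (#|{: 'I_n * 'I_n}|%:R ^+ ((0 < n) * m)) <= reject_prob sampling_tester M.
Proof.
have := sample_prob_sum1; rewrite (bigID (accepts (T:=sampling_tester) M)) /=.
rewrite -/(accept_prob sampling_tester M) -/(reject_prob sampling_tester M) => sum1.
set p := _ / _; suff : accept_prob sampling_tester M <= p by move: sum1; lra.
rewrite /accept_prob sumr_const -[_ *+ _]mulr_natl card_tuple natrX.
rewrite ler_wpM2r ?invr_ge0 ?exprn_ge0 // ler_nat.
apply/subset_leq_card/subsetP => s; rewrite inE => /existsP[N /andP[rkN /eqP]].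
exact: consistent_bool_rank.
Qed.

End SamplingTester.

(** Compare [M] with its light matrix, of rank at most [d]: wrongly covered zeros number at most
    [d * n * theta = eps * n ^ 2 / 2], half of the distance. *)
Lemma far_beneficial (R : realType) (n d : nat) (eps : R) (M : 'M[bool]_n)
    (st : 'I_d -> {set 'I_n} * {set 'I_n}) :
  (0 < d)%N -> 0 < eps -> far_from_bool_rank d eps M ->
  eps / 2 * #|{: 'I_n * 'I_n}|%:R <=
    #|beneficial M (eps * n%:R / (2 * d%:R)) st|%:R.
Proof.
move=> d0 eps0 far; set theta := eps * _ / _.
have d1 : 1 <= d%:R :> R by rewrite ler1n.
have theta0 : 0 <= theta by rewrite divr_ge0 ?mulr_ge0 // ltW.
have := far _ (bool_rank_light_mx M theta st).
move/lt_le_trans/(_ (dist_light_mx M st theta0)).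
rewrite card_prod card_ord mulnn.
rewrite (_ : (d * n)%:R * theta = eps / 2 * (n ^ 2)%:R); first by lra.
by rewrite natrM natrX /theta; field; rewrite pnatr_eq0 -lt0n.
Qed.

(** The initial weight [2 * d * n] over [theta], rounded to a larger integer; [n] cancels. *)
Definition potential_bound (R : realType) (d : nat) (eps : R) : nat :=
  (Num.truncn (4 * d%:R ^+ 2 / eps)).+1.

(** The logarithm is at least [ln (2 * d)] and [ln 3]: of its [D + 1] copies, [D] offset
    [(2 * d) ^ D] and one yields the factor 1/3. *)
Definition sample_size (R : realType) (d : nat) (eps : R) : nat :=
  (Num.truncn (4 / eps * ((potential_bound d eps)%:R + 1) *
               ln (2 + d%:R ^+ 4 / eps ^+ 6))).+1.

(** * Numerical estimates for the sample size *)

Section SampleSize.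
Variables (R : realType) (d : nat) (eps : R).
Hypotheses (d0 : (0 < d)%N) (eps01 : 0 < eps <= 1).

Local Notation g := (d%:R ^+ 4 / eps ^+ 6 : R).
Local Notation L := (ln (2 + g)).

Let d1 : 1 <= d%:R :> R. Proof. by rewrite ler1n. Qed.
Let e0 : 0 < eps. Proof. by case/andP: eps01. Qed.
Let e1 : eps <= 1. Proof. by case/andP: eps01. Qed.

Lemma le_potential_bound : 4 * d%:R ^+ 2 / eps <= (potential_bound d eps)%:R.
Proof. exact/ltW/truncnS_gt. Qed.

Let g_ge : d%:R ^+ 4 <= g.
Proof. by rewrite ler_pdivlMr ?exprn_gt0 // ler_piMr ?exprn_ge0 // exprn_ile1 // ltW. Qed.

Let g1 : 1 <= g. Proof. by rewrite (le_trans _ g_ge) // exprn_ege1. Qed.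

Let expL : expR L = 2 + g. Proof. by rewrite lnK // posrE; have := g1; lra. Qed.

(** Uses [ln y <= y - 1] at [y = 1 / (2 + g) <= 1 / 2]. *)
Let L_ge : 1 / 2 <= L.
Proof.
have gt2 : 2 < 2 + g by have := g1; lra.
have h : ln (2 + g)^-1 = - L by rewrite lnV // posrE; lra.
have i2 : (2 + g)^-1 <= 2^-1 by rewrite lef_pV2 ?posrE; lra.
have i0 : 0 < (2 + g)^-1 by rewrite invr_gt0; lra.
move: (2 + g)^-1 h i2 i0 => y h i2 i0.
have : ln (1 + (y - 1)) <= y - 1 by apply: le_ln1Dx; lra.
have -> : 1 + (y - 1) = y by ring.
by rewrite h; lra.
Qed.

Lemma sample_size_survival :
  (2 * d%:R) ^+ potential_bound d eps * (1 - eps / 4) ^+ sample_size d eps <= 1 / 3.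
Proof.
set D := potential_bound d eps; set m := sample_size d eps.
have mL : 4 / eps * (D%:R + 1) * L <= m%:R by exact/ltW/truncnS_gt.
have hd : 2 * d%:R <= expR L.
  have : 2 * d%:R <= 2 + d%:R ^+ 4 :> R; last by rewrite expL; have := g_ge; lra.
  (* The squares sum to [d ^ 4 - d ^ 2 - 2 * d + 2]. *)
  by have : 0 <= (d%:R ^+ 2 - 1) ^+ 2 + (d%:R - 1) ^+ 2 :> R; [rewrite addr_ge0 ?sqr_ge0|nra].
have h3 : 3 <= expR L by rewrite expL; have := g1; lra.
move: L mL hd h3 => l ml hd h3.
have q0 : 0 <= 1 - eps / 4 by have := e1; lra.
have dd0 : 0 <= 2 * d%:R :> R by rewrite mulr_ge0.
have pm : (1 - eps / 4) ^+ m <= expR (- ((D%:R + 1) * l)).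
  apply: (@le_trans _ _ (expR (m%:R * - (eps / 4)))).
    by rewrite expRM_natl lerXn2r ?nnegrE ?expR_ge0 ?expR_ge1Dx.
  rewrite ler_expR mulrN lerN2.
  have -> : (D%:R + 1) * l = eps / 4 * (4 / eps * (D%:R + 1) * l).
    by field; rewrite gt_eqF.
  by rewrite [leRHS]mulrC ler_wpM2l // divr_ge0 // ltW.
have pD : (2 * d%:R) ^+ D <= expR (D%:R * l).
  by rewrite expRM_natl lerXn2r ?nnegrE ?expR_ge0.
apply: (le_trans (ler_pM (exprn_ge0 _ dd0) (exprn_ge0 _ q0) pD pm)).
rewrite -expRD (_ : _ + _ = - l); last by ring.
by rewrite expRN div1r lef_pV2 // posrE ?expR_gt0.
Qed.

Lemma sample_size_sqr_le :
  (sample_size d eps * sample_size d eps)%:R <= soft_bound 676 2 g.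
Proof.
set D := potential_bound d eps; set m := sample_size d eps.
set i := eps^-1; have i1 : 1 <= i by rewrite invf_ge1.
have i0 : 0 <= i by rewrite (le_trans ler01).
have DE : D%:R <= 4 * d%:R ^+ 2 * i + 1.
  by rewrite /D /potential_bound -natr1 lerD2r truncn_le !mulr_ge0.
have di : 1 <= d%:R ^+ 2 * i by rewrite mulr_ege1 // exprn_ege1.
have mE : m%:R <= 4 * i * (D%:R + 1) * L + 1.
  rewrite /m /sample_size -natr1 lerD2r truncn_le !mulr_ge0 ?addr_ge0 //.
  by rewrite (le_trans _ L_ge) // divr_ge0.
(* [m ^ 2] grows like [i ^ 4], which is at most [i ^ 6] as [i >= 1]. *)
have gE : d%:R ^+ 4 * i ^+ 4 <= g by rewrite ler_wpM2l ?exprn_ge0 // -exprVn ler_weXn2l.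
rewrite /soft_bound; move: g L L_ge gE mE => G l l_ge GE mE.
have l0 : 0 <= l by rewrite (le_trans _ l_ge) // divr_ge0.
set B := d%:R ^+ 2 * i ^+ 2 * l.
have mB : m%:R <= 26 * B.
  (* Here [D + 1 <= 4 * d ^ 2 * i + 2 <= 6 * d ^ 2 * i]. *)
  have h : 4 * i * (D%:R + 1) * l <= 24 * B.
    have -> : 24 * B = 4 * i * (6 * (d%:R ^+ 2 * i)) * l by rewrite /B; ring.
    by rewrite ler_wpM2r ?ler_wpM2l ?mulr_ge0 //; lra.
  (* The rounding term 1 in [m] is absorbed because [l >= 1 / 2]; hence 26 = 24 + 2 and 676 = 26 ^
     2. *)
  have : 1 <= 2 * B; last by lra.
  have -> : 2 * B = ((d%:R ^+ 2 * i) * i) * (2 * l) by rewrite /B; ring.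
  by apply: mulr_ege1; [exact: mulr_ege1 | lra].
rewrite natrM (le_trans (ler_pM _ _ mB mB)) //.
have -> : 26 * B * (26 * B) = 676 * (d%:R ^+ 4 * i ^+ 4 * l ^+ 2) by rewrite /B; ring.
by rewrite ler_wpM2l // ler_wpM2r ?exprn_ge0.
Qed.

End SampleSize.

Theorem theorem1 (R : realType) :
  exists (T : forall (n d : nat) (eps : R), nonadaptive_tester R n)
         (C : R) (k : nat),
  forall (n d : nat) (eps : R), (0 < d)%N -> 0 < eps <= 1 ->
    [/\ (query_complexity (T n d eps))%:R
          <= soft_bound C k (d%:R ^+ 4 / eps ^+ 6),
        forall M : 'M[bool]_n, (bool_rank M <= d)%N ->
          accept_prob (T n d eps) M = 1
      & forall M : 'M[bool]_n, far_from_bool_rank d eps M ->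
          2 / 3 <= reject_prob (T n d eps) M].
Proof.
exists (fun n d eps => sampling_tester R n d (sample_size d eps)), 676, 2%N.
move=> n d eps d0 eps01; have /andP[e0 e1] := eps01; split.
- apply: le_trans (sample_size_sqr_le d0 eps01).
  by rewrite ler_nat query_complexity_sampling.
- by move=> M; exact: accept_prob_sampling.
move=> M far; apply: le_trans (reject_prob_sampling _ _ _ _).
pose st (_ : 'I_d) := ([set: 'I_n], [set: 'I_n]).
(* For [n = 0] no matrix is far: all distances are 0 and farness is strict. *)
have n0 : (0 < n)%N.
  case: (posnP n) => // n0; have := far _ (bool_rank_light_mx M (0 : R) st).
  have -> : mx_dist M (light_mx M (0 : R) st) = 0%N.
    by apply/eqP; rewrite -leqn0 (leq_trans (max_card _)) // card_prod card_ord n0.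
  by rewrite ltNge mulr_ge0 // ltW.
rewrite n0 mul1n.
have d1 : 1 <= d%:R :> R by rewrite ler1n.
have n1 : 1 <= n%:R :> R by rewrite ler1n.
set theta := eps * n%:R / (2 * d%:R).
have theta0 : 0 < theta by rewrite divr_gt0 ?mulr_gt0 //; lra.
have wst : (weight st)%:R <= (potential_bound d eps)%:R * theta.
  apply: (@le_trans _ _ (4 * d%:R ^+ 2 / eps * theta)); last first.
    by rewrite ler_wpM2r ?le_potential_bound // ltW.
  rewrite /weight /= big_const_ord iter_addn_0 cardsT card_ord natrM natrD le_eqVlt.
  apply/orP; left; apply/eqP; rewrite /theta; field.
  by rewrite !gt_eqF //; lra.
have q01 : 0 <= eps / 2 <= 1 by lra.
have := sample_size_survival d0 eps01.
move: (potential_bound d eps) (sample_size d eps) wst => D m wst survival.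
have := card_consistent m d0 theta0 q01 (fun st' => far_beneficial st' d0 e0 far) wst.
set K := #|[set _ | _]|; set N : R := #|{: 'I_n * 'I_n}|%:R => HK.
have N0 : 0 < N ^+ m.
  by rewrite exprn_gt0 // ltr0n card_prod card_ord muln_gt0 n0.
(* The fraction of consistent samples remains; [q = eps / 2] gives the decay factor
   [1 - eps / 4]. *)
suff : K%:R / N ^+ m <= 1 / 3 by move: (_ / N ^+ m) => p; lra.
rewrite ler_pdivrMr // (le_trans HK) // [(_ * _) ^+ m]exprMn mulrA ler_wpM2r ?(ltW N0) //.
rewrite (_ : 1 - eps / 2 / 2 = 1 - eps / 4); last by field.
exact: survival.
Qed.
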